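(* For a positive integer $n$, $$\sum_{k=1}^n \frac{1}{k}|\mathcal{T}_{n,k}| = \sum_{k=1}^n \frac{1}{k}|\mathcal{F}_{n,k}| = n^n.$$
   Context: $\mathcal{T}_n$ is the set of rooted labeled trees on vertex set $[0,n]=\{0,\dots,n\}$. For $T\in\mathcal{T}_n$, the maximal decreasing subtree $\mathrm{MD}(T)$ is the subtree induced by the root and all vertices $v$ such that labels strictly decrease along the path from the root to $v$. $\mathcal{T}_{n,k}$ is the set of $T\in\mathcal{T}_n$ whose $\mathrm{MD}(T)$ has exactly $k+1$ vertices. $[n]=\{1,\dots,n\}$, and $\mathcal{F}_{n,k}$ is the set of functions $f:[n]\to[n]$ whose image contains $\{1,\dots,k\}$. *)

(* Defs.v *)
From mathcomp Require Import all_boot.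

Set Implicit Arguments.
Unset Strict Implicit.
Unset Printing Implicit Defensive.

Section Graph.
Variable V : finType.

Definition adj (E : {set {set V}}) : rel V :=
  fun x y => (x != y) && ([set x; y] \in E).

Definition simple_graph (E : {set {set V}}) : bool :=
  [forall e in E, #|e| == 2].

Definition connected_graph (E : {set {set V}}) : bool :=
  [forall x, forall y, connect (adj E) x y].

(* A duplicate-free sequence of vertices has length at most #|V|, so bounding
   the length of c loses no cycle. *)
Definition acyclic_graph (E : {set {set V}}) : bool :=
  [forall c : #|V|.-bseq V, ~~ [&& 2 < size c, uniq c & cycle (adj E) c]].

Definition is_tree (E : {set {set V}}) : bool :=
  [&& simple_graph E, connected_graph E & acyclic_graph E].

End Graph.

(* A rooted labeled tree on {0, ..., n} is a pair (root, edge set); every choice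
   of root is allowed. *)
Definition rtrees (n : nat) : {set 'I_n.+1 * {set {set 'I_n.+1}}} :=
  [set T | is_tree T.2].

(* The vertex set of MD(T). The simple path from the root T.1 to v, which is
   unique when T is a tree, is T.1 :: p. *)
Definition MD (n : nat) (T : 'I_n.+1 * {set {set 'I_n.+1}}) : {set 'I_n.+1} :=
  [set v | [exists p : #|'I_n.+1|.-bseq 'I_n.+1,
     [&& path (adj T.2) T.1 p, uniq (T.1 :: p), last T.1 p == v
       & sorted (fun x y : 'I_n.+1 => y < x) (T.1 :: p)]]].

Definition rtreesMD (n k : nat) : {set 'I_n.+1 * {set {set 'I_n.+1}}} :=
  [set T in rtrees n | #|MD T| == k.+1].

(* The element i of 'I_n stands for the integer i + 1 of [n] = {1, ..., n}. *)
Definition funs_onto_first (n k : nat) : {set {ffun 'I_n -> 'I_n}} :=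
  [set f : {ffun 'I_n -> 'I_n} |
    [forall i : 'I_n, (i.+1 <= k) ==> (i \in codom f)]].

(* Main.v *)
Require Import Defs.
From mathcomp Require Import all_boot all_order all_algebra.
From mathcomp Require Import ring zify.
Import GRing.Theory Num.Theory.
Local Open Scope ring_scope.

Set Implicit Arguments.
Unset Strict Implicit.
Unset Printing Implicit Defensive.

(* Functions. Let F(n, k) count the maps [n] -> [N] whose image contains k given
   points. Conditioning on one value gives F(n+1, k) = (N - k) F(n, k) + k F(n, k-1),
   so L(n) = sum_k F(n, k) / k satisfies L(n+1) = N L(n) + N^n, whence
   L(n) = n N^(n-1).

   Trees. A rooted tree is a pair (r, f) of a root and a parent map. Fix the root
   and the vertex set S of MD(T), with |S| = k + 1, and everything outside S. Inside
   S each x <> r picks a parent among the larger elements of S: k! choices, of which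
   (k - 1)! use the root only once. Hence |T_{n,k}| / k counts the trees of T_{n,k}
   whose root has exactly one smaller child, and the sum over k counts all trees
   with that property. By the forest formula, the number of these with root r is
   r (2n + 1 - r) n^(r-2) (n+1)^(n-r-1) = G(r+1) - G(r), where
   G(r) = r (r - 1) n^(r-2) (n+1)^(n-r), and G(n+1) = n^n. *)

(** * Binomial sums *)

Section BinomialSums.
Variable F : fieldType.

Lemma sum_subsets_card (V : finType) (U : {set V}) (h : nat -> F) :
  \sum_(C : {set V} | C \subset U) h #|C| =
  \sum_(i < #|U|.+1) 'C(#|U|, i)%:R * h i.
Proof.
rewrite (partition_big (fun C : {set V} => inord #|C| : 'I_#|U|.+1) xpredT) //=.
apply: eq_bigr => i _.
rewrite -cards_draws -[X in X%:R]sum1_card natr_sum mulr_suml.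
apply: eq_big => [C|C /andP[sCU /eqP <-]]; last first.
  by rewrite inordK ?mul1r // ltnS subset_leq_card.
rewrite inE; case sCU: (C \subset U) => //=.
by rewrite -val_eqE /= inordK // ltnS subset_leq_card.
Qed.

(** Pascal's rule splits the sum for [m.+1] and [a] into the one for [m] and [a] plus [x] times the
    one for [m] and [a + 1]. The factor [1 + x] avoids the exponent m - 1. *)
Lemma sum_bin_affine (m : nat) (a x : F) :
  (1 + x) * (\sum_(i < m.+1) 'C(m, i)%:R * ((a + i%:R) * x ^+ i)) =
  (a * (1 + x) + m%:R * x) * (1 + x) ^+ m.
Proof.
elim: m a => [|m IHm] a.
  by rewrite big_ord1 /= bin0; ring.
rewrite big_ord_recl bin0 /=.
under eq_bigr => i _ do rewrite /bump /= add1n binS natrD mulrDl.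
rewrite big_split /=.
have -> : \sum_(i < m.+1) 'C(m, i)%:R * ((a + i.+1%:R) * x ^+ i.+1) =
          x * \sum_(i < m.+1) 'C(m, i)%:R * ((a + 1 + i%:R) * x ^+ i).
  rewrite mulr_sumr; apply: eq_bigr => i _.
  by rewrite exprS -natr1; ring.
have -> : \sum_(i < m.+1) 'C(m, i.+1)%:R * ((a + i.+1%:R) * x ^+ i.+1) =
          \sum_(i < m.+1) 'C(m, i)%:R * ((a + i%:R) * x ^+ i) - a.
  rewrite big_ord_recr /= bin_small // mul0r addr0 big_ord_recl /= bin0.
  by under [in RHS]eq_bigr do rewrite /bump /= add1n; ring.
have := IHm a; have := IHm (a + 1).
set S2 := (X in _ * X = _); set S1 := (X in _ -> _ * X = _ -> _) => IH2 IH1.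
transitivity ((1 + x) * S1 + x * ((1 + x) * S2)); first by rewrite -/S1 -/S2 /= expr0; ring.
by rewrite IH1 IH2 exprS -natr1; ring.
Qed.

End BinomialSums.

Lemma card_ord_lt (n k : nat) : (k <= n)%N -> #|[set i : 'I_n | (i < k)%N]| = k.
Proof.
move=> kn; rewrite -[RHS](card_ord k).
have widen_inj : injective (widen_ord kn).
  by move=> i j /(congr1 val) /= ij; apply: val_inj.
rewrite -(card_imset predT widen_inj); apply: eq_card => i; rewrite inE.
apply/idP/imsetP => [ik|[j _ ->]]; last exact: (ltn_ord j).
by exists (Ordinal ik) => //; apply: val_inj.
Qed.

(** * Functions with prescribed values *)

Lemma sum_ffun_ord_recl (R : nmodType) (T : finType) (n : nat)
    (h : {ffun 'I_n.+1 -> T} -> R) :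
  \sum_f h f = \sum_(y : T) \sum_(g : {ffun 'I_n -> T})
     h [ffun i => oapp g y (unlift ord0 i)].
Proof.
rewrite pair_big /=.
rewrite (reindex (fun p : T * {ffun 'I_n -> T} =>
   [ffun i => oapp p.2 p.1 (unlift ord0 i)])) //=.
exists (fun f : {ffun 'I_n.+1 -> T} => (f ord0, [ffun i => f (lift ord0 i)])).
  move=> [y g] _ /=; congr (_, _); first by rewrite ffunE unlift_none.
  by apply/ffunP => i; rewrite !ffunE liftK.
move=> f _; apply/ffunP => i; rewrite ffunE /=.
by case: unliftP => [j ->|->] /=; rewrite ?ffunE.
Qed.

(** Domain and codomain sizes are independent, so that the recursion can shorten the domain alone;
    [A] is arbitrary because deleting a point spoils an initial segment. *)
Definition ncover (n N : nat) (A : {set 'I_N}) :=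
  #|[set f : {ffun 'I_n -> 'I_N} | A \subset codom f]|.

Lemma ncover_rec n N (A : {set 'I_N}) :
  ncover n.+1 A = (\sum_(y : 'I_N) ncover n (A :\ y))%N.
Proof.
rewrite /ncover -sum1_card big_mkcond /=.
rewrite (@sum_ffun_ord_recl nat) /=.
apply: eq_bigr => y _; rewrite -big_mkcond /= -sum1_card.
apply: eq_bigl => g; rewrite !inE.
have cons_codom z : (z \in codom [ffun i => oapp g y (unlift ord0 i)]) =
    (z == y) || (z \in codom g).
  apply/codomP/orP => [[i ->]|[/eqP->|/codomP[i ->]]].
  - by rewrite ffunE; case: unliftP => [j _|_] /=; [right; rewrite codom_f|left].
  - by exists ord0; rewrite ffunE unlift_none.
  - by exists (lift ord0 i); rewrite ffunE liftK.
apply/subsetP/subsetP => sA z.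
  by rewrite !inE => /andP[/negPf zy /sA]; rewrite cons_codom zy.
by move=> zA; rewrite cons_codom; case: eqP => //= /eqP zy; apply: sA; rewrite !inE zy.
Qed.

(** The recursion of [ncover], by size alone. Rational values keep [N%:R - k%:R] from being
    truncated, and at k = 0 the term with [k.-1] has coefficient zero. *)
Fixpoint cover_count (N n k : nat) : rat :=
  if n is n'.+1 then
    (N%:R - k%:R) * cover_count N n' k + k%:R * cover_count N n' k.-1
  else (k == 0)%:R.

Lemma ncoverE n N (A : {set 'I_N}) :
  (ncover n A)%:R = cover_count N n #|A|.
Proof.
elim: n A => [|n IHn] A /=.
  rewrite /ncover; case: (eqVneq A set0) => [->|A0].
    rewrite cards0 (eq_card (B := predT)); last first.
      by move=> f; rewrite !inE; apply/subsetP => z; rewrite inE.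
    by rewrite card_ffun !card_ord.
  rewrite cards_eq0 (negPf A0) eq_card0 // => f; rewrite !inE.
  apply: contraNF A0 => /subsetP sA; apply/eqP/setP => z; rewrite inE.
  by apply/negP => /sA/codomP[[]].
rewrite ncover_rec natr_sum (bigID (mem A)) /= addrC; congr (_ + _).
  rewrite (eq_bigr (fun=> cover_count N n #|A|)) => [|y yA]; last first.
    by rewrite IHn; congr cover_count; move: (cardsD1 y A); rewrite (negPf yA).
  rewrite sumr_const -[LHS]mulr_natl; congr (_ * _).
  have /(congr1 (fun m => m%:R : rat)) := cardC (mem A).
  by rewrite card_ord natrD => <-; rewrite [RHS]addrC addKr.
rewrite (eq_bigr (fun=> cover_count N n #|A|.-1)) => [|y yA]; last first.
  by rewrite IHn; congr cover_count; rewrite (cardsD1 y A) yA.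
by rewrite sumr_const -[LHS]mulr_natl.
Qed.

Lemma cover_count0 N n : cover_count N n 0 = N%:R ^+ n.
Proof. by elim: n => [|n IHn] /=; rewrite ?expr0 // IHn exprS; ring. Qed.

Lemma cover_count_small N n k : (n < k)%N -> cover_count N n k = 0.
Proof.
elim: n k => [|n IHn] [|k] //= nk.
by rewrite (IHn k) // (IHn k.+1) ?(ltnW nk) // !mulr0 addr0.
Qed.

(** Divided by k, the recursion yields N times the previous summand plus a difference that
    telescopes to [N%:R ^+ n]. One bound [K] serves the whole induction. *)
Lemma sum_cover_count N n K : (n <= K)%N ->
  \sum_(1 <= k < K.+1) k%:R^-1 * cover_count N n k = n%:R * N%:R ^+ n.-1.
Proof.
elim: n => [_|n IHn nK].
  by rewrite big_nat big1 ?mul0r // => k /andP[k1 _]; rewrite /= gtn_eqF ?mulr0.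
rewrite (eq_big_nat _ _ (F2 := fun k => N%:R * (k%:R^-1 * cover_count N n k) +
   (cover_count N n k.-1 - cover_count N n k))); last first.
  move=> [//|k] /andP[_ _] /=.
  have k0 : k.+1%:R != 0 :> rat by rewrite pnatr_eq0.
  by move: (k.+1%:R : rat) k0 => q q0; field.
rewrite big_split /= -mulr_sumr IHn ?(ltnW nK) //.
rewrite big_add1 /= big_mkord.
have -> : \sum_(i < K) (cover_count N n i - cover_count N n i.+1) = N%:R ^+ n.
  rewrite -(big_mkord xpredT (fun i => cover_count N n i - cover_count N n i.+1)).
  rewrite (telescope_sumr_eq (fun i => - cover_count N n i)) //.
    by rewrite cover_count0 cover_count_small // oppr0 opprK add0r.
  by move=> i _; rewrite opprK addrC.
(* At n = 0 the exponent [n.-1] is truncated, but its factor n vanishes. *)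
case: n {IHn nK} => [|n]; first by rewrite mul0r mulr0 add0r mul1r.
by rewrite -[n.+2%:R]natr1 /= exprS; ring.
Qed.

Lemma sum_funs_onto_first n : (0 < n)%N ->
  \sum_(1 <= k < n.+1) (k%:R^-1 * #|funs_onto_first n k|%:R : rat) = n%:R ^+ n.
Proof.
move=> n0; rewrite -[n in RHS](prednK n0) [in RHS]exprS (prednK n0).
rewrite -(sum_cover_count _ (leqnn n)); apply: eq_big_nat => k /andP[_ kn].
congr (_ * _); pose A := [set i : 'I_n | (i.+1 <= k)%N].
have kA : k = #|A| by rewrite (card_ord_lt (kn : (k <= n)%N)).
rewrite {2}kA -ncoverE; congr _%:R; apply: eq_card => f; rewrite !inE.
apply/forallP/subsetP => [h i|h i]; first by rewrite inE => ik; apply: (implyP (h i)).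
by apply/implyP => ik; apply: h; rewrite inE.
Qed.

(** * Forests *)

Section Forests.
Variable V : finType.
Implicit Types (U Z C W : {set V}) (f g : {ffun V -> V}).

(* For a parent map f, this says that every vertex of U eventually leaves U under
   iteration of f, i.e. that f has no cycle inside U. *)
Definition grounded U f :=
  [forall W : {set V}, (W != set0) && (W \subset U) ==>
     [exists x in W, f x \notin W]].

Lemma groundedP U f :
  reflect (forall W, W != set0 -> W \subset U -> exists2 x, x \in W & f x \notin W)
          (grounded U f).
Proof.
apply: (iffP forallP) => h W; first by move=> W0 WU; apply/exists_inP/(implyP (h W))/andP.
by apply/implyP => /andP[W0 WU]; apply/exists_inP/h.
Qed.

(* Forests on Z with root set Z \ U; the condition off U only normalizes f. *)
Definition forests U Z : {set {ffun V -> V}} :=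
  [set f | [&& grounded U f, [forall x in U, f x \in Z]
             & [forall x in ~: U, f x == x]]].

Lemma forestsP U Z f :
  reflect [/\ grounded U f, {in U, forall x, f x \in Z} & forall x, x \notin U -> f x = x]
          (f \in forests U Z).
Proof.
rewrite inE; apply: (iffP and3P) => [[gf /forall_inP fZ /forall_inP ff]|[gf fZ ff]].
  by split=> // x xU; apply/eqP/ff; rewrite inE.
split=> //; apply/forall_inP => // x; rewrite inE => xU; exact/eqP/ff.
Qed.

Definition children f (U : {set V}) z : {set V} := [set x in U | f x == z].

(** A child of [z] leaves [U] in one step, since [z] lies outside [U], so no cycle inside [U] passes
    through it. *)
Lemma grounded_children U z f C : z \notin U -> children f U z = C ->
  grounded U f = grounded (U :\: C) f.
Proof.
move=> zU <-; apply/groundedP/groundedP => h W W0 WU.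
  by apply: h => //; apply: subset_trans WU (subsetDl _ _).
have [/set0Pn[x]|] := boolP (W :&: children f U z != set0).
  rewrite !inE => /and3P[xW xU /eqP fx]; exists x => //; rewrite fx.
  by apply: contra zU; apply: (subsetP WU).
by rewrite negbK setI_eq0 => WC; apply: h => //; rewrite subsetD WU.
Qed.

Lemma eq_grounded U f g : {in U, f =1 g} -> grounded U f = grounded U g.
Proof.
move=> fg; apply/groundedP/groundedP => h W W0 WU;
  have [x xW fx] := h W W0 WU;
  by exists x => //; move: fx; rewrite fg // (subsetP WU).
Qed.

(** Deleting the root [z] turns its children into roots. *)
Lemma card_forests_children U Z z C : z \in Z -> z \notin U -> C \subset U ->
  #|[set f in forests U Z | children f U z == C]| = #|forests (U :\: C) (Z :\ z)|.
Proof.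
move=> zZ zU CU.
(* The inverse operation hangs [C] back under [z]. It is injective because the maps of the smaller
   forest fix [C] pointwise. *)
pose ext f : {ffun V -> V} := [ffun x => if x \in C then z else f x].
have ext_inj : {in forests (U :\: C) (Z :\ z) &, injective ext}.
  move=> f g /forestsP[_ _ ff] /forestsP[_ _ gg] /ffunP e; apply/ffunP => x.
  have := e x; rewrite !ffunE; case: ifP => // xC _.
  by rewrite ff ?gg // inE xC.
rewrite -(card_in_imset ext_inj); apply: eq_card => f.
apply/idP/imsetP => [|[g /forestsP[gg gZ gi] ->]].
  rewrite inE => /andP[/forestsP[gf fZ ff] /eqP fC].
  exists [ffun x => if x \in C then x else f x]; last first.
    apply/ffunP => x; rewrite !ffunE; have [|//] := boolP (x \in C).
    by rewrite -fC inE => /andP[_ /eqP].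
  apply/forestsP; split.
  - rewrite (@eq_grounded _ _ f) -?(grounded_children _ fC) // => x.
    by rewrite inE ffunE => /andP[/negPf -> _].
  - move=> x; rewrite !inE ffunE => /andP[xC xU]; rewrite (negPf xC) fZ // andbT.
    by apply: contra xC => fx; rewrite -fC inE xU.
  - move=> x; rewrite inE ffunE; case: ifP => //= xC xU; exact: ff.
have gC : children (ext g) U z = C.
  apply/setP => x; rewrite inE ffunE; case: ifP => [/(subsetP CU) ->|xC]; first by rewrite eqxx.
  case xU: (x \in U) => //=.
  by have := gZ x; rewrite !inE xC xU => /(_ isT) /andP[/negPf].
rewrite inE gC eqxx andbT; apply/forestsP; split.
- rewrite (grounded_children _ gC) // (@eq_grounded _ _ g) // => x.
  by rewrite inE ffunE => /andP[/negPf -> _].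
- move=> x xU; rewrite ffunE; case: ifP => // xC.
  by have := gZ x; rewrite !inE xC xU => /(_ isT) /andP[].
- move=> x xU; rewrite ffunE; case: ifP => [/(subsetP CU)|xC]; first by rewrite (negPf xU).
  by apply: gi; rewrite inE negb_and xU orbT.
Qed.

(* Cayley's formula (|Z| - |U|) |Z|^(|U| - 1), multiplied by |Z| to avoid the negative
   exponent when U is empty. *)
Lemma card_forests U Z : U \subset Z ->
  #|forests U Z|%:R * #|Z|%:R = (#|Z|%:R - #|U|%:R) * #|Z|%:R ^+ #|U| :> rat.
Proof.
move: {2}#|Z| (erefl #|Z|) => m; elim: m U Z => [|m IHm] U Z Zm UZ.
  by move: (subset_leq_card UZ); rewrite Zm leqn0 => /eqP ->; rewrite mulr0 subrr mul0r.
have [->|U0] := eqVneq U set0.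
  rewrite cards0 subr0 mulrC; congr (_ * _).
  rewrite (_ : forests _ _ = [set [ffun x => x]]) ?cards1 //; apply/setP => f.
  rewrite [in RHS]inE; apply/forestsP/eqP => [[_ _ ff]|->].
    by apply/ffunP => x; rewrite ffunE ff // inE.
  split=> [|x|x _]; rewrite ?inE ?ffunE //; apply/groundedP => W W0.
  by rewrite subset0 (negPf W0).
(* Without a root, [Z] itself would be closed under [f]. *)
have [UeqZ|/subsetPn[z zZ zU]] := boolP (Z \subset U).
  have -> : U = Z by apply/eqP; rewrite eqEsubset UZ.
  rewrite subrr mul0r (_ : forests _ _ = set0) ?cards0 ?mul0r //; apply/setP => f.
  rewrite [in RHS]inE; apply/negP => /forestsP[/groundedP gf fZ _].
  have [||x xZ] := gf Z; rewrite ?fZ //.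
  by apply: contraNneq U0 => Z0; rewrite -subset0 -Z0.
have Zz : #|Z :\ z| = m by have := cardsD1 z Z; rewrite zZ Zm => -[].
have UZz : U \subset Z :\ z by rewrite subsetD1 UZ.
have m0 : m%:R != 0 :> rat.
  rewrite pnatr_eq0 -lt0n -Zz card_gt0; apply: contraNneq U0 => Zz0.
  by rewrite -subset0 -Zz0.
(* Split by the set [C] of children of the root [z]: the remaining forest has m vertices and m - |U|
   + |C| roots. *)
have -> : #|forests U Z|%:R = \sum_(C : {set V} | C \subset U)
    ((m%:R - #|U|%:R + #|C|%:R) * m%:R ^- #|C| * m%:R ^+ #|U| / m%:R : rat).
  rewrite -sum1_card (partition_big (fun f => children f U z) (fun C => C \subset U)) /=; last first.
    by move=> f _; apply/subsetP => x; rewrite inE => /andP[].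
  rewrite natr_sum; apply: eq_bigr => C CU.
  rewrite -[X in X%:R](_ : #|[set f in forests U Z | children f U z == C]| = _); last first.
    by rewrite -sum1_card; apply: eq_bigl => f; rewrite inE.
  rewrite card_forests_children //; apply: (canRL (mulfK m0)).
  have := IHm (U :\: C) (Z :\ z) Zz; rewrite Zz => ->; last first.
    exact: subset_trans (subsetDl _ _) UZz.
  have UC : #|U| = (#|C| + #|U :\: C|)%N by rewrite -(cardsID C U) (setIidPr CU).
  rewrite UC natrD exprD; field; exact: expf_neq0.
rewrite (@sum_subsets_card _ _ U (fun i => (m%:R - #|U|%:R + i%:R) * m%:R ^- i * m%:R ^+ #|U| / m%:R)).
(* At x = 1/m the factor 1 + x is |Z| / m, whence the power of |Z|. *)
have := @sum_bin_affine _ #|U| (m%:R - #|U|%:R : rat) m%:R^-1.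
rewrite Zm -natr1.
have -> : 1 + m%:R^-1 = (m%:R + 1) / m%:R :> rat by field.
set s := \sum_(i < _) _ => es.
rewrite (eq_bigr (fun i : 'I_#|U|.+1 => 'C(#|U|, i)%:R * ((m%:R - #|U|%:R + i%:R) * m%:R^-1 ^+ i)
   * (m%:R ^+ #|U| / m%:R : rat))); last by move=> i _; rewrite exprVn; ring.
rewrite -mulr_suml -/s.
transitivity (((m%:R + 1) / m%:R * s) * m%:R ^+ #|U|); first by field.
by rewrite es expr_div_n; field; rewrite m0 expf_neq0.
Qed.

End Forests.

(** * Roots with exactly one smaller child *)

Section RootedTrees.
Variable n : nat.
Local Notation V := 'I_n.+1.
Implicit Types (r : V) (f : {ffun V -> V}).

(** The normalization off [[set~ r]] makes the root its own parent. *)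
Definition parent_maps r : {set {ffun V -> V}} := forests [set~ r] setT.

(** These are the children of the root inside MD(T); strictness excludes [r], its own parent. *)
Definition smaller_children f r : {set V} := [set x : V | (x < r)%N && (f x == r)].

Definition split_root f r := #|smaller_children f r| == 1%N.

Lemma card_below r : #|[set x : V | (x < r)%N]| = r.
Proof. by rewrite card_ord_lt // ltnW. Qed.

Lemma card_above r : #|[set x : V | (r < x)%N]| = (n - r)%N.
Proof.
have := cardsC [set x : V | (x <= r)%N]; rewrite card_ord.
have -> : ~: [set x : V | (x <= r)%N] = [set x : V | (r < x)%N].
  by apply/setP => x; rewrite !inE ltnNge.
have -> : [set x : V | (x <= r)%N] = r |: [set x : V | (x < r)%N].
  by apply/setP => x; rewrite !inE leq_eqVlt.
rewrite cardsU1 inE ltnn card_below; lia.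
Qed.

(** Such a [C] is one of the r elements below [r] together with any set [D] above it. *)
Lemma sum_one_below r (h : nat -> rat) :
  \sum_(C : {set V} | (C \subset [set~ r]) && (#|C :&: [set x : V | (x < r)%N]| == 1%N)) h #|C| =
  r%:R * \sum_(D : {set V} | D \subset [set x : V | (r < x)%N]) h #|D|.+1.
Proof.
have {1}-> : r%:R = \sum_(x : V | (x < r)%N) 1 :> rat.
  by rewrite sumr_const -{1}(card_below r); congr _%:R; apply: eq_card => x; rewrite inE.
rewrite mulr_suml.
under [in RHS]eq_bigr do rewrite mul1r.
rewrite pair_big_dep /=.
(* On the sets concerned the intersection is a singleton, so the default [r] is never taken. *)
rewrite (reindex_onto (fun p : V * {set V} => p.1 |: p.2)
  (fun C : {set V} => (odflt r [pick x in C :&: [set x : V | (x < r)%N]],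
             C :&: [set x : V | (r < x)%N]))) /=; last first.
  move=> C /andP[Cr /cards1P[a Ca]].
  have ain : a \in C :&: [set x : V | (x < r)%N] by rewrite Ca inE.
  have -> : [pick x in C :&: [set x : V | (x < r)%N]] = Some a.
    by case: pickP => [x|/(_ a)]; rewrite Ca !inE ?eqxx // => /eqP ->.
  apply/setP => x /=; rewrite !inE.
  have /setP/(_ x) := Ca; rewrite !inE => <-.
  case xC: (x \in C) => //=; have /(subsetP Cr) := xC.
  by rewrite !inE -val_eqE /=; case: ltngtP.
have aDP (a : V) (D : {set V}) : (a < r)%N -> D \subset [set x : V | (r < x)%N] ->
    (a |: D) :&: [set x : V | (x < r)%N] = [set a].
  move=> ar /subsetP DG; apply/setP => x; rewrite !inE; case: eqP => [->|_] //=.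
  by apply/andP => -[/DG]; rewrite inE => /ltnW; rewrite leqNgt => /negP.
have aDG (a : V) (D : {set V}) : (a < r)%N -> D \subset [set x : V | (r < x)%N] ->
    (a |: D) :&: [set x : V | (r < x)%N] = D.
  move=> ar /subsetP DG; apply/setP => x; rewrite !inE.
  case xD: (x \in D); first by have := DG x xD; rewrite inE orbT.
  by rewrite orbF; case: eqP => [->|_] //=; rewrite ltnNge ltnW.
have aDinv (a : V) (D : {set V}) : (#|(a |: D) :&: [set x : V | (x < r)%N]| == 1%N) ->
    (odflt r [pick x in (a |: D) :&: [set x : V | (x < r)%N]],
     (a |: D) :&: [set x : V | (r < x)%N]) = (a, D) ->
    (a < r)%N /\ D \subset [set x : V | (r < x)%N].
  move=> /cards1P[b b1] [e eD].
  have bin : b \in (a |: D) :&: [set x : V | (x < r)%N] by rewrite b1 inE.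
  split; last by rewrite -eD subsetIr.
  move: e; case: pickP => [x|/(_ b)]; last by rewrite bin.
  by move=> xin /= <-; move: xin; rewrite !inE => /andP[].
apply: eq_big => [[a D]|[a D]] /=; last first.
  move=> /andP[/andP[_ c1] /eqP aD]; congr h.
  have [ar /subsetP DG] := aDinv _ _ c1 aD.
  rewrite cardsU1; case aiD: (a \in D) => //.
  by have := DG a aiD; rewrite inE ltnNge ltnW.
apply/idP/andP => [/andP[/andP[_ c1] /eqP aD]|[ar DG]]; first exact: aDinv.
rewrite !aDP // !aDG // cards1 eqxx andbT.
case: pickP => [x|/(_ a)]; rewrite !inE ?eqxx // => /eqP ->; rewrite eqxx andbT.
apply/subsetP => y; rewrite !inE => /orP[/eqP ->|/(subsetP DG)]; rewrite ?inE -val_eqE /=.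
  by rewrite ltn_eqF.
by move=> ry; rewrite gtn_eqF.
Qed.

(** Deleting the root leaves a forest on n vertices whose root set is the set [C] of its children;
    there are |C| n^(n-|C|-1) of these. The factor on the left clears negative exponents. *)
Lemma card_split_root r :
  #|[set f in parent_maps r | split_root f r]|%:R * (n.+1%:R * n%:R ^+ 2) =
  r%:R * (n.+1 + n - r)%:R * n%:R ^+ r * n.+1%:R ^+ (n - r) :> rat.
Proof.
have [n0|n0] := posnP n.
  have r0 : r = 0%N :> nat by have := ltn_ord r; lia.
  have nz : n%:R = 0 :> rat by rewrite n0.
  by rewrite nz r0 expr2 !mulr0 !mul0r.
have nR : n%:R != 0 :> rat by rewrite pnatr_eq0 -lt0n.
have cr : #|[set: V] :\ r| = n.
  by have := cardsD1 r setT; rewrite cardsT card_ord inE => -[].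
have childrenI f : children f [set~ r] r :&: [set x : V | (x < r)%N] = smaller_children f r.
  by apply/setP => x; rewrite !inE -val_eqE /=; case: ltngtP; rewrite ?andbT ?andbF.
have -> : #|[set f in parent_maps r | split_root f r]|%:R =
    \sum_(C : {set V} | (C \subset [set~ r]) && (#|C :&: [set x : V | (x < r)%N]| == 1%N))
      (#|C|%:R * n%:R ^- #|C| * n%:R ^+ n / n%:R : rat).
  rewrite -sum1_card (partition_big (fun f => children f [set~ r] r)
    (fun C => (C \subset [set~ r]) && (#|C :&: [set x : V | (x < r)%N]| == 1%N))) /=; last first.
    move=> f; rewrite inE => /andP[_ sf]; rewrite childrenI -/(split_root f r) sf andbT.
    by apply/subsetP => x; rewrite inE => /andP[].
  rewrite natr_sum; apply: eq_bigr => C /andP[CU C1].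
  rewrite -[X in X%:R](_ : #|[set f in parent_maps r | children f [set~ r] r == C]| = _); last first.
    rewrite -sum1_card; apply: eq_bigl => f; rewrite !inE.
    case: eqP => [fC|]; rewrite ?andbF // !andbT /split_root -childrenI fC C1.
    by rewrite andbT.
  rewrite card_forests_children ?inE ?eqxx //; apply: (canRL (mulfK nR)).
  have := @card_forests _ ([set~ r] :\: C) ([set: V] :\ r).
  rewrite cr => ->; last by apply/subsetP => x; rewrite !inE => /andP[_ ->].
  have UC : n = (#|C| + #|[set~ r] :\: C|)%N.
    by rewrite -{1}(setIidPr CU) cardsID -[LHS]cr setTD.
  have -> : n%:R ^+ n = n%:R ^+ #|C| * n%:R ^+ #|[set~ r] :\: C| :> rat.
    by rewrite -exprD -UC.
  have {1}-> : n%:R = #|C|%:R + #|[set~ r] :\: C|%:R :> rat by rewrite -natrD -UC.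
  by field; rewrite expf_neq0.
rewrite (@sum_one_below r (fun c => c%:R * n%:R ^- c * n%:R ^+ n / n%:R)).
rewrite (@sum_subsets_card _ _ _ (fun c => c.+1%:R * n%:R ^- c.+1 * n%:R ^+ n / n%:R)).
rewrite card_above; set M := (n - r)%N.
have := @sum_bin_affine _ M (1 : rat) n%:R^-1.
set s := \sum_(i < _) _ => es.
rewrite (eq_bigr (fun i : 'I_M.+1 => 'C(M, i)%:R * ((1 + i%:R) * n%:R^-1 ^+ i)
   * (n%:R ^+ n / n%:R / n%:R : rat))); last first.
  by move=> i _; rewrite exprVn -natr1 exprS; field; rewrite nR expf_neq0.
rewrite -mulr_suml -/s.
have nM : n = (r + M)%N by rewrite subnKC // -ltnS ltn_ord.
have -> : (n.+1 + n - r)%N = (n.+1 + M)%N by rewrite {2}nM; lia.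
have e1 : 1 + n%:R^-1 = n.+1%:R / n%:R :> rat by rewrite -natr1; field.
rewrite e1 in es.
transitivity (r%:R * (n.+1%:R / n%:R * s) * n%:R ^+ n * n%:R); first by field.
have -> : n%:R ^+ n = n%:R ^+ r * n%:R ^+ M :> rat by rewrite -exprD -nM.
rewrite es expr_div_n natrD.
by field; rewrite nR expf_neq0.
Qed.

Lemma sum_card_split_root : (0 < n)%N ->
  (\sum_r #|[set f in parent_maps r | split_root f r]|)%N%:R = n%:R ^+ n :> rat.
Proof.
move=> n0.
have nR : n%:R != 0 :> rat by rewrite pnatr_eq0 -lt0n.
have n1R : n.+1%:R != 0 :> rat by rewrite pnatr_eq0.
(* An antidifference of the count, over a common denominator; it vanishes at 0 and equals n^n at n +
   1. *)
pose G (r : nat) : rat := r%:R * (r%:R - 1) * n%:R ^+ r * n.+1%:R ^+ (n.+1 - r) /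
  (n%:R ^+ 2 * n.+1%:R).
rewrite natr_sum.
rewrite (eq_bigr (fun r : V => G r.+1 - G r)) => [|r _]; last first.
  rewrite -[LHS](mulfK (_ : n.+1%:R * n%:R ^+ 2 != 0)) ?mulf_neq0 ?expf_neq0 //.
  rewrite card_split_root /G subSS; have rn : (r <= n)%N by rewrite -ltnS ltn_ord.
  rewrite subSn // !exprS natrB; last by lia.
  rewrite natrD -!natr1.
  by field; rewrite natr1 n1R.
rewrite -(big_mkord xpredT (fun i => G i.+1 - G i)) telescope_sumr // /G subnn.
rewrite exprS -natr1; field.
by rewrite natr1 n1R.
Qed.

End RootedTrees.

(** * Rearranging the maximal decreasing subtree *)

Section MaximalDecreasing.
Variable n : nat.
Local Notation V := 'I_n.+1.
Implicit Types (r x y : V) (f g : {ffun V -> V}) (S W : {set V}).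

Lemma exists_max S z : z \in S -> exists2 c, c \in S & {in S, forall x, (x <= c)%N}.
Proof. by move=> zS; case: (arg_maxnP (fun x : V => x : nat) zS) => c; exists c. Qed.

(** The element with j larger ones in [S] contributes j + 1, so the factors are 1, ..., |S|.
    Removing the minimum changes no other factor. *)
Lemma prod_card_above S :
  (\prod_(x in S) #|[set y in S | (x < y)%N]|.+1)%N = #|S|`!.
Proof.
move: {2}#|S| (erefl #|S|) => m; elim: m S => [|m IHm] S Sm.
  by move/eqP: Sm; rewrite cards_eq0 => /eqP ->; rewrite big_set0 cards0.
have /set0Pn[z zS] : S != set0 by rewrite -card_gt0 Sm.
pose a := [arg min_(x < z in S) (x : nat)].
have [aS amin] : a \in S /\ {in S, forall x, (a <= x)%N}.
  by rewrite /a; case: arg_minnP.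
have Sa : #|S :\ a| = m by have := cardsD1 a S; rewrite aS Sm => -[].
rewrite (big_setD1 a) //= Sm factS -Sa -IHm //; congr (_ * _)%N.
  congr _.+1; apply: eq_card => y; rewrite !inE andbC -val_eqE /=.
  by case yS: (y \in S); rewrite ?andbF //= !andbT ltn_neqAle (amin y) // andbT eq_sym.
apply: eq_bigr => x; rewrite !inE => /andP[_ xS]; congr _.+1; apply: eq_card => y.
rewrite !inE; case: eqP => [->|] //=; apply/negbTE.
by rewrite aS /= -leqNgt amin.
Qed.

Lemma card_constrained S (A : V -> {set V}) g :
  #|family (fun x => mem (if x \in S then A x else [set g x]))| =
  (\prod_(x in S) #|A x|)%N.
Proof.
rewrite card_family foldrE big_map big_enum /= [RHS]big_mkcond.
by apply: eq_bigr => x _; case: ifP; rewrite ?cards1.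
Qed.

(** For a parent map, a local form of the statement that [S] is the vertex set of MD(T), free of
    paths. *)
Definition isMD f r S :=
  (r \in S) && [forall x, (x != r) ==> ((x \in S) == (f x \in S) && (x < f x)%N)].

Definition MD_maps r S : {set {ffun V -> V}} := [set f in parent_maps r | isMD f r S].

Lemma MD_mapsP r S f :
  reflect [/\ grounded [set~ r] f, f r = r, r \in S &
     forall x, x != r -> (x \in S) = (f x \in S) && (x < f x)%N]
   (f \in MD_maps r S).
Proof.
rewrite inE; apply: (iffP andP) => [[/forestsP[gf _ ff] /andP[rS /forallP h]]|[gf fr rS h]].
  by split=> // [|x xr]; [apply: ff; rewrite !inE eqxx|apply/eqP/(implyP (h x))].
split; last first.
  by rewrite /isMD rS; apply/forallP => x; apply/implyP => xr; apply/eqP/h.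
by apply/forestsP; split=> // x; rewrite !inE // negbK => /eqP ->.
Qed.

(** Membership of a vertex is determined by that of its parent, so the set [W] of disagreements
    would be closed under [f]. *)
Lemma isMD_inj f r S S' : grounded [set~ r] f -> isMD f r S -> isMD f r S' -> S = S'.
Proof.
move=> /groundedP gf /andP[rS /forallP h] /andP[rS' /forallP h'].
pose W := [set x | (x \in S) != (x \in S')].
have [W0|W0] := eqVneq W set0.
  by apply/setP => x; have /setP/(_ x) := W0; rewrite !inE => /negbFE/eqP.
have [|x] := gf W W0.
  by apply/subsetP => x; rewrite !inE; apply: contraNneq => ->; rewrite rS rS'.
rewrite !inE negbK => xW /eqP fW; move: xW.
have [->|xr] := eqVneq x r; first by rewrite rS rS'.
by rewrite (eqP (implyP (h x) xr)) (eqP (implyP (h' x) xr)) fW eqxx.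
Qed.

(** Inside [S] labels grow towards the parent, so the vertices of [S] above [r] form a set closed
    under [f]. *)
Lemma MD_maps_ltn r S f x : f \in MD_maps r S -> x \in S -> x != r -> (x < r)%N.
Proof.
move=> /MD_mapsP[/groundedP gf fr rS h] xS xr; rewrite ltnNge; apply/negP => rx.
have [||y] := gf [set y in S | (r <= y)%N && (y != r)].
- by apply/set0Pn; exists x; rewrite inE xS rx xr.
- by apply/subsetP => y; rewrite !inE => /and3P[].
rewrite !inE => /and3P[yS ry yr]; have := h y yr; rewrite yS => /esym/andP[-> yf].
by rewrite (ltnW (leq_ltn_trans ry yf)) -val_eqE /= gtn_eqF // (leq_ltn_trans ry yf).
Qed.

(* Canonical representative of the parent maps that differ from f only inside S. *)
Definition star f r S : {ffun V -> V} := [ffun x => if x \in S then r else f x].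

Lemma star_idem f r S : star (star f r S) r S = star f r S.
Proof. by apply/ffunP => x; rewrite !ffunE; case: (x \in S). Qed.

Lemma star_MD_maps r S f : f \in MD_maps r S -> star f r S \in MD_maps r S.
Proof.
move=> fX; have /MD_mapsP[/groundedP gf fr rS h] := fX; apply/MD_mapsP; split=> //.
- apply/groundedP => W W0 Wr; have [/set0Pn[x]|] := boolP (W :&: S != set0).
    rewrite inE => /andP[xW xS]; exists x; rewrite // ffunE xS.
    by apply/negP => /(subsetP Wr); rewrite !inE eqxx.
  rewrite negbK setI_eq0 => dWS; have [x xW fx] := gf W W0 Wr; exists x => //.
  by rewrite ffunE (disjointFr dWS xW).
- by rewrite ffunE rS.
- move=> x xr; rewrite ffunE; case: ifP => [xS|xS]; last by rewrite -h.
  by rewrite rS (MD_maps_ltn fX).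
Qed.

(** Larger parents inside [S] can be chosen independently: increasing labels exclude cycles, and
    vertices outside [S] keep their parents, so [S] remains the set of MD(T). *)
Lemma star_fiber r S g f : g \in MD_maps r S -> star g r S = g ->
  (f \in MD_maps r S) && (star f r S == g) =
  (f \in family (fun x => mem (if x \in S :\ r then [set y in S | (x < y)%N] else [set g x]))).
Proof.
move=> gX gS; have /MD_mapsP[/groundedP gg gr rS hg] := gX.
apply/andP/familyP => [[/MD_mapsP[_ fr _ h] /eqP e] x|h].
  case: ifP; rewrite !inE.
    by move=> /andP[xr xS]; have := h x xr; rewrite xS => /esym/andP[-> ->].
  have [->|xr] := eqVneq x r; first by rewrite fr gr.
  by rewrite -e ffunE /= => ->.
have hS x : x \in S -> x != r -> (f x \in S) /\ (x < f x)%N.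
  by move=> xS xr; have := h x; rewrite !inE xr xS /= inE => /andP[].
have hN x : x \notin S -> f x = g x.
  by move=> xS; have := h x; rewrite !inE (negPf xS) andbF inE => /eqP.
have fr : f r = r by have := h r; rewrite !inE eqxx inE gr => /eqP.
split; last first.
  apply/eqP/ffunP => x; rewrite -gS !ffunE; case: ifP => // /negbT; exact: hN.
apply/MD_mapsP; split=> //.
  (* The largest vertex of [W :&: S] has a still larger parent in [S], hence outside [W]. *)
  apply/groundedP => W W0 Wr; have [/set0Pn[z zWS]|] := boolP (W :&: S != set0).
    have [x /setIP[xW xS] xmax] := exists_max zWS.
    have xr : x != r by have := subsetP Wr x xW; rewrite !inE.
    have [fS xf] := hS x xS xr; exists x => //; apply/negP => fW.
    by have := xmax (f x); rewrite inE fW fS leqNgt xf => /(_ isT).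
  rewrite negbK setI_eq0 => dWS; have [x xW fx] := gg W W0 Wr; exists x => //.
  by rewrite hN ?(disjointFr dWS xW).
move=> x xr; case xS: (x \in S); first by have [-> ->] := hS x xS xr.
by rewrite hN ?xS // -hg.
Qed.

(** Each fibre of [star] has (|S| - 1)! elements: a vertex with j larger ones in [S :\ r] has j + 1
    possible parents, since [r] exceeds them all. *)
Lemma card_MD_maps r S :
  #|MD_maps r S| = (#|[set g in MD_maps r S | star g r S == g]| * #|S|.-1`!)%N.
Proof.
rewrite -sum1_card (partition_big (fun f => star f r S)
   (fun g => g \in [set g in MD_maps r S | star g r S == g])); last first.
  by move=> f fX; rewrite inE star_MD_maps // star_idem eqxx.
rewrite -sum_nat_const; apply: eq_bigr => g /setIdP[gX /eqP gS].
have /MD_mapsP[_ _ rS _] := gX.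
rewrite (eq_bigl _ _ (fun f => star_fiber f gX gS)) sum1_card card_constrained.
have -> : #|S|.-1 = #|S :\ r| by rewrite (cardsD1 r S) rS.
rewrite -prod_card_above; apply: eq_bigr => x; rewrite !inE => /andP[xr xS].
rewrite (cardsD1 r) inE rS (MD_maps_ltn gX) // add1n; congr _.+1.
by apply: eq_card => y; rewrite !inE andbA.
Qed.

(** The largest vertex [c] of [S :\ r] must have parent [r], so it is the only smaller child
    allowed. Every other vertex chooses a larger parent in [S :\ r], where [c] takes over the part
    of the root: (|S| - 2)! choices per fibre. *)
Lemma card_MD_maps_split r S : (1 < #|S|)%N ->
  #|[set f in MD_maps r S | split_root f r]| =
  (#|[set g in MD_maps r S | star g r S == g]| * #|S|.-2`!)%N.
Proof.
move=> S1.
rewrite -sum1_card (partition_big (fun f => star f r S)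
   (fun g => g \in [set g in MD_maps r S | star g r S == g])); last first.
  by move=> f /setIdP[fX _]; rewrite inE star_MD_maps // star_idem eqxx.
rewrite -sum_nat_const; apply: eq_bigr => g /setIdP[gX /eqP gS].
have /MD_mapsP[_ gr rS _] := gX.
have /set0Pn[z zS] : S :\ r != set0.
  by rewrite -card_gt0; move: S1; rewrite (cardsD1 r S) rS.
have [c cS cmax] := exists_max zS.
have [cr cS'] : c != r /\ c \in S by move: cS; rewrite !inE => /andP[].
(* At [c] the singleton [[set g x]] is [[set r]], as [g] is fixed by [star]. *)
have fiberE f : (f \in [set f in MD_maps r S | split_root f r]) && (star f r S == g) =
  (f \in family (fun x => mem (if x \in S :\ r :\ c
                               then [set y in S :\ r | (x < y)%N] else [set g x]))).
  rewrite inE andbAC star_fiber //.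
  apply/andP/familyP => [[/familyP h sf] x|h].
    have fc : f c = r.
      have := h c; rewrite cS !inE => /andP[fS cf]; apply/eqP; apply: contraTT cf => fr.
      by rewrite -leqNgt cmax // !inE fr.
    have csm : c \in smaller_children f r by rewrite inE fc eqxx (MD_maps_ltn gX).
    have := h x; rewrite [x \in S :\ r :\ c]in_setD1.
    have [xS|_] := boolP (x \in S :\ r); last by rewrite andbF.
    rewrite inE => /andP[fS xf]; case: eqP => [->|/eqP xc] /=.
      by rewrite inE fc -{1}gS ffunE cS'.
    rewrite !inE fS xf !andbT; apply: contra xc => /eqP fx.
    have /cards1P[b eb] := sf; move: csm; rewrite eb inE => /eqP ->.
    have : x \in smaller_children f r.
      by move: xS => /setD1P[xr xS]; rewrite inE fx eqxx (MD_maps_ltn gX).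
    by rewrite eb inE.
  have fc : f c = r.
    by have := h c; rewrite !inE eqxx /= inE -gS ffunE cS' => /eqP.
  have fam : f \in family (fun x => mem (if x \in S :\ r then [set y in S | (x < y)%N] else [set g x])).
    apply/familyP => x; have := h x; rewrite [x \in S :\ r :\ c]in_setD1; case: (eqVneq x c) => [->|xc] /=.
      by rewrite cS !inE fc rS (MD_maps_ltn gX).
    by case: ifP => // _; rewrite !inE => /andP[/andP[_ ->] ->].
  split=> //.
  have : (f \in MD_maps r S) && (star f r S == g) by rewrite star_fiber.
  move=> /andP[/MD_mapsP[_ _ _ hf] _].
  apply/cards1P; exists c; apply/setP => x; rewrite !inE.
  have [->|xc] := eqVneq x c; first by rewrite fc eqxx (MD_maps_ltn gX).
  apply/andP => -[xr /eqP fx].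
  have xr' : x != r by rewrite -val_eqE /= ltn_eqF.
  have xS : x \in S by rewrite hf // fx rS.
  by have := h x; rewrite !inE xc xr' xS /= !inE fx eqxx.
rewrite (eq_bigl _ _ fiberE) sum1_card card_constrained.
have e : #|S|.-2 = #|S :\ r :\ c|.
  by rewrite (cardsD1 r S) rS (cardsD1 c (S :\ r)) cS.
rewrite e -prod_card_above; apply: eq_bigr => x; rewrite !inE => /and3P[xc xr xS].
rewrite (cardsD1 c) !inE cr cS' /=.
have -> : (x < c)%N by rewrite ltn_neqAle -[_ == _ :> nat]/(x == c) xc cmax // !inE xr.
by rewrite add1n; congr _.+1; apply: eq_card => y; rewrite !inE !andbA.
Qed.

Lemma card_MD_maps_ratio r S : (1 < #|S|)%N ->
  #|MD_maps r S| = (#|S|.-1 * #|[set f in MD_maps r S | split_root f r]|)%N.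
Proof.
move=> S1; rewrite card_MD_maps card_MD_maps_split //.
by case: #|S| S1 => [|[|k]] // _; rewrite /= factS mulnCA.
Qed.

End MaximalDecreasing.

(** * Trees as parent maps *)

(** Once the cycle is rotated to start at [x], the successor is the second entry and the predecessor
    the last. *)
Lemma next_neq_prev (T : eqType) (c : seq T) x :
  uniq c -> (2 < size c)%N -> x \in c -> next c x != prev c x.
Proof.
move=> uc c2 xc; have [i s ci] := rot_to xc.
rewrite -(next_rot i uc) -(prev_rot i uc) ci.
move: uc c2; rewrite -(rot_uniq i) -(size_rot i) ci.
case: s {ci} => [|y s] //= /and3P[]; rewrite inE negb_or => /andP[xy xs] ys _ s2.
rewrite eqxx (negPf xy); case: s => [//|z s] in xs ys s2 *.
have prev_last (t : seq T) w : x \notin t -> prev_at x x w t = last w t.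
  elim: t w => [|v t IHt] w /=; first by rewrite eqxx.
  by rewrite inE negb_or => /andP[/negPf -> /IHt].
by rewrite prev_last //=; apply: contraNneq ys => ->; exact: mem_last.
Qed.

(** * The graph of a parent map *)

Section ParentGraph.
Variable n : nat.
Local Notation V := 'I_n.+1.
Implicit Types (r x y : V) (f g : {ffun V -> V}) (W : {set V}) (E : {set {set V}}).

Definition parent_edges r f : {set {set V}} := [set [set x; f x] | x in [set~ r]].

Lemma parent_mapsP r f :
  reflect (grounded [set~ r] f /\ f r = r) (f \in parent_maps r).
Proof.
rewrite /parent_maps; apply: (iffP (forestsP _ _ _)) => [[gf _ ff]|[gf fr]].
  by split=> //; apply: ff; rewrite !inE eqxx.
by split=> // x; rewrite !inE // negbK => /eqP ->.
Qed.

Lemma adj_sym (T : finType) (F : {set {set T}}) : symmetric (adj F).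
Proof. by move=> x y; rewrite /adj eq_sym setUC. Qed.

Lemma adj_parent_edges r f x y :
  adj (parent_edges r f) x y =
  (x != y) && ((x != r) && (f x == y) || (y != r) && (f y == x)).
Proof.
rewrite /adj; have [//|xy /=] := eqVneq x y.
apply/imsetP/orP => [[z]|[/andP[xr /eqP fx]|/andP[yr /eqP fy]]]; last 2 first.
- by exists x; rewrite ?fx // !inE.
- by exists y; [rewrite !inE|rewrite fy setUC].
rewrite !inE => zr e; have : z \in [set x; y] by rewrite e set21.
rewrite !inE => /orP[] /eqP zE; subst z.
  left; rewrite zr /=; have : y \in [set x; f x] by rewrite -e set22.
  by rewrite !inE eq_sym (negPf xy) /= eq_sym.
right; rewrite zr /=; have : x \in [set y; f y] by rewrite -e set21.
by rewrite !inE (negPf xy) /= eq_sym.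
Qed.

Lemma parent_neq r f x : grounded [set~ r] f -> x != r -> f x != x.
Proof.
move=> /groundedP gf xr; have [||y] := gf [set x].
- by apply/set0Pn; exists x; rewrite inE.
- by rewrite sub1set !inE.
by rewrite !inE => /eqP ->.
Qed.

Lemma simple_parent_edges r f :
  grounded [set~ r] f -> simple_graph (parent_edges r f).
Proof.
move=> gf; apply/forall_inP => e /imsetP[x]; rewrite !inE => xr ->.
by rewrite cards2 [x == _]eq_sym (parent_neq gf xr).
Qed.

Lemma adj_parent r f x : grounded [set~ r] f -> x != r -> adj (parent_edges r f) x (f x).
Proof.
by move=> gf xr; rewrite adj_parent_edges xr eqxx eq_sym (parent_neq gf xr).
Qed.

(** The vertices not connected to the root would form a set closed under [f]. *)
Lemma connected_parent_edges r f :
  grounded [set~ r] f -> connected_graph (parent_edges r f).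
Proof.
move=> gf; have csym : connect_sym (adj (parent_edges r f)).
  by apply: sym_connect_sym; exact: adj_sym.
have xr x : connect (adj (parent_edges r f)) x r.
  apply: contraT => xr; have /groundedP := gf.
  move=> /(_ [set z | ~~ connect (adj (parent_edges r f)) z r]) [||z].
  - by apply/set0Pn; exists x; rewrite inE.
  - by apply/subsetP => z; rewrite !inE; apply: contraNneq => ->; exact: connect0.
  rewrite !inE negbK => zr fzr; have z_r : z != r by apply: contraNneq zr => ->.
  by case/negP: zr; apply: connect_trans fzr; exact/connect1/adj_parent.
by apply/forallP => x; apply/forallP => y; apply: connect_trans (xr x) _; rewrite csym.
Qed.

Lemma acyclic_parent_edges r f :
  grounded [set~ r] f -> f r = r -> acyclic_graph (parent_edges r f).
Proof.
move=> gf fr; have /groundedP gW := gf; apply/forallP => c; apply/negP => /and3P[c2 uc cc].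
have adjn x : x \in (c : seq V) -> adj (parent_edges r f) x (next c x).
  by move=> xc; exact: next_cycle.
(* A vertex has one parent, so if that of x is next c x then x is the parent of
   prev c x: A is stable under prev, hence, by counting, under next, i.e. under f. *)
pose A := [set x in (c : seq V) | (x != r) && (f x == next c x)].
have prevA : prev c @: A \subset A.
  apply/subsetP => _ /imsetP[x] + ->; rewrite inE => /and3P[xc xr /eqP fx].
  have := adjn (prev c x); rewrite mem_prev xc => /(_ isT).
  rewrite next_prev // adj_parent_edges inE mem_prev xc /= next_prev // => /andP[_ /orP[//|]].
  by rewrite fx (negPf (next_neq_prev uc c2 xc)) andbF.
have prevAE : prev c @: A = A.
  apply/eqP; rewrite eqEcard prevA card_imset ?leqnn //=.
  exact: (can_inj (next_prev uc)).
have A0 : A = set0.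
  apply/eqP; apply: contraT => A0; have [|x xA fxA] := gW A A0.
    by apply/subsetP => x; rewrite !inE => /and3P[].
  case/negP: fxA; have := xA; rewrite -{1}prevAE => /imsetP[y yA xy].
  have : next c x = y by rewrite xy next_prev.
  by have := xA; rewrite inE => /and3P[_ _ /eqP ->] ->.
(* As [A] is empty, the edge between [prev c x] and [x] can only be the parent edge of [x]. *)
have prevP x : x \in (c : seq V) -> (x != r) /\ f x = prev c x.
  move=> xc; have := adjn (prev c x); rewrite mem_prev xc => /(_ isT).
  rewrite next_prev // adj_parent_edges => /andP[_ /orP[/andP[pr fp]|/andP[xr /eqP]]] //.
  have : prev c x \in A by rewrite inE mem_prev xc pr next_prev.
  by rewrite A0 inE.
(* So the whole cycle is closed under [f], against groundedness. *)
have [||x] := gW [set x in (c : seq V)].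
- case: (c : seq V) c2 => // x s _; apply/set0Pn; exists x; rewrite inE; exact: mem_head.
- by apply/subsetP => x; rewrite !inE => /prevP[].
by rewrite !inE => xc; have [_ ->] := prevP x xc; rewrite mem_prev xc.
Qed.

(** Take [x] where [f] and [g] differ while they agree at [f x]. The edge from [x] to [f x] forces
    [g (f x) = x], so [f] swaps the two vertices, a cycle. *)
Lemma parent_edges_inj r : {in parent_maps r &, injective (parent_edges r)}.
Proof.
move=> f g /parent_mapsP[gf fr] /parent_mapsP[gg gr] efg.
have /groundedP gW := gf; pose W := [set x | f x != g x].
have [W0|W0] := eqVneq W set0.
  by apply/ffunP => x; have /setP/(_ x) := W0; rewrite !inE => /negbFE/eqP.
have Wr x : x \in W -> x != r by rewrite inE; apply: contraNneq => ->; rewrite fr gr.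
have [|x xW fxW] := gW W W0; first by apply/subsetP => x /Wr; rewrite !inE.
have xr := Wr x xW.
have := adj_parent gf xr; rewrite efg adj_parent_edges xr => /andP[_ /orP[/eqP gx|]].
  by move: xW; rewrite inE gx eqxx.
move=> /andP[fxr /eqP gfx].
have ffx : f (f x) = x by move: fxW; rewrite inE negbK => /eqP ->.
have [||y] := gW [set x; f x].
- by apply/set0Pn; exists x; rewrite set21.
- by apply/subsetP => y; rewrite !inE => /orP[] /eqP ->.
by rewrite !inE => /orP[] /eqP ->; rewrite ?ffx eqxx ?orbT.
Qed.

End ParentGraph.

(** * From trees back to parent maps *)

Lemma connect_exit (T : finType) (e : rel T) (A : {set T}) x y :
  connect e x y -> x \in A -> y \notin A -> exists a b, [/\ a \in A, b \notin A & e a b].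
Proof.
move=> /connectP[p]; elim: p x => [|z p IHp] x /= => [_ -> ->//|].
move=> /andP[xz pz] yE xA yA; case zA: (z \in A); first exact: (IHp z).
by exists x, z; rewrite xA zA xz.
Qed.

Section Trees.
Variable n : nat.
Local Notation V := 'I_n.+1.
Implicit Types (r x y : V) (f g : {ffun V -> V}) (U W : {set V}) (E : {set {set V}}).

(** The tree is grown from [r]: while a vertex is missing, connectedness gives an edge from some [a]
    in [U] to some [b] outside, and [b] receives the parent [a]. *)
Lemma spanning_parent_map E r : connected_graph E ->
  exists2 f, f \in parent_maps r & forall x, x != r -> adj E x (f x).
Proof.
move=> /forallP conn.
have grow m : (m <= n)%N -> exists U f, [/\ #|U| = m.+1, r \in U,
    grounded (U :\ r) f & {in U :\ r, forall x, adj E x (f x) && (f x \in U)}].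
  elim: m => [_|m IHm mn].
    exists [set r], [ffun x => x]; rewrite cards1 set11 setDv.
    split=> //; last by move=> x; rewrite inE.
    by apply/groundedP => W W0; rewrite subset0 (negPf W0).
  have [U [f [Um rU /groundedP gf fU]]] := IHm (ltnW mn).
  have /subsetPn[z _ zU] : ~~ (setT \subset U).
    by apply/negP => /subset_leq_card; rewrite cardsT card_ord Um ltnNge mn.
  have [a [b [aU bU ab]]] := connect_exit (forallP (conn r) z) rU zU.
  exists (b |: U), [ffun x => if x == b then a else f x]; split.
  - by rewrite cardsU1 bU Um.
  - by rewrite !inE rU orbT.
  - apply/groundedP => W W0 /subsetP Wr.
    have WU x : x \in W -> x != b -> x \in U :\ r.
      by move=> /Wr; rewrite !inE => /andP[-> /orP[->|->]].
    (* If [W] is [b] alone, its parent [a] lies outside; otherwise the old map gives a vertex of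
       [W :\ b] whose parent is in [U], hence not [b]. *)
    have [W1|W1] := eqVneq (W :\ b) set0.
      have Wb x : x \in W -> x = b.
        by move=> xW; have /setP/(_ x) := W1; rewrite !inE xW andbT => /negbFE/eqP.
      have /set0Pn[x xW] := W0; exists x => //; have xb := Wb x xW.
      rewrite ffunE xb eqxx; apply/negP => /Wb ab'.
      by move: aU bU; rewrite ab' => ->.
    have [|x] := gf _ W1.
      by apply/subsetP => x /setD1P[xb xW]; exact: WU.
    rewrite !inE => /andP[xb xW] fx; exists x; rewrite // ffunE (negPf xb).
    apply: contra fx => ->; rewrite andbT; apply: contraNneq bU => <-.
    by have /andP[] := fU x (WU x xW xb).
  - move=> x; rewrite !inE ffunE => /andP[xr]; case: eqP => [-> _|_ /= xU].
      by rewrite (adj_sym E) ab aU orbT.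
    by have := fU x; rewrite !inE xr xU => /(_ isT)/andP[-> ->]; rewrite orbT.
have [U [f [Un _ /groundedP gf fU]]] := grow n (leqnn n).
have UT : U = setT by apply/eqP; rewrite eqEcard subsetT cardsT card_ord Un /=.
(* The invariant says nothing of the value at the root, which is set here. *)
exists [ffun x => if x == r then r else f x] => [|x xr]; last first.
  by rewrite ffunE (negPf xr); have := fU x; rewrite UT !inE xr => /(_ isT)/andP[].
apply/parent_mapsP; rewrite ffunE eqxx; split=> //; apply/groundedP => W W0 Wr.
have [|x xW fx] := gf W W0; first by rewrite UT setTD.
exists x; rewrite // ffunE ifN //.
by have := subsetP Wr x xW; rewrite !inE.
Qed.

(** An edge of [E] outside the spanning parent map would close one of its paths into a cycle. *)
Lemma tree_parent_map E r : is_tree E ->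
  exists2 f, f \in parent_maps r & parent_edges r f = E.
Proof.
move=> /and3P[/forall_inP sE cE /forallP aE].
have [f fP fE] := spanning_parent_map r cE; exists f => //.
have /parent_mapsP[gf _] := fP.
have fsub : parent_edges r f \subset E.
  by apply/subsetP => _ /imsetP[x xr ->]; have := fE x; rewrite !inE in xr *; case/(_ xr)/andP.
have adj_sub x y : adj (parent_edges r f) x y -> adj E x y.
  by move=> /andP[xy /(subsetP fsub) e]; rewrite /adj xy.
apply/eqP; rewrite eqEsubset fsub; apply/subsetP => e eE.
have /cards2P[x [y [xy eq_e]]] := sE e eE; rewrite eq_e in eE *; apply: contraT => eN.
have /forallP/(_ x)/forallP/(_ y)/connectP[p0 pp0 yE] := connected_parent_edges gf.
move: yE; case/shortenP: pp0 => p pp up _ yE.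
(* A path of one step would make [e] a parent edge. *)
have psize : (2 < size (x :: p))%N.
  case: p pp up yE => [_ _ yx|z [|//] /= /andP[xz _] _ yz].
    by move: xy; rewrite yx eqxx.
  by case/andP: xz => _; rewrite -yz (negPf eN).
have csize : (size (x :: p) <= #|V|)%N by rewrite -(card_uniqP up) max_card.
case/negP: (aE (Bseq csize)); apply/and3P; split; [exact: psize|exact: up|].
by rewrite /= rcons_path (sub_path adj_sub pp) -yE (adj_sym E) /adj xy.
Qed.

Lemma parent_map_tree r f : f \in parent_maps r -> is_tree (parent_edges r f).
Proof.
move=> /parent_mapsP[gf fr]; apply/and3P; split.
- exact: simple_parent_edges.
- exact: connected_parent_edges.
- exact: acyclic_parent_edges.
Qed.

(** The first step cannot go to the parent of [x], so it goes to a child. The parent of that child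
    is [x], which does not recur, and the argument repeats. *)
Lemma path_from_root r f x p : path (adj (parent_edges r f)) x p -> uniq (x :: p) ->
  f x \notin p -> path (fun a b => f b == a) x p.
Proof.
elim: p x => [//|y p IHp] x /= /andP[xy yp] /andP[xNyp /andP[yNp up]].
move: xNyp; rewrite !inE !negb_or => /andP[_ xNp] /andP[fxy _]; move: xy.
rewrite adj_parent_edges (negPf fxy) andbF /= => /and3P[_ _ /eqP fy].
by rewrite fy eqxx IHp //= ?yNp // fy.
Qed.

Lemma path_to_root r f x p : r \notin p ->
  path (fun a b => (f b == a) && (b < a)%N) x p -> path (adj (parent_edges r f)) x p.
Proof.
elim: p x => [//|y p IHp] x; rewrite inE negb_or eq_sym => /andP[yr rp] /=.
move=> /andP[/andP[/eqP fy yx] /(IHp _ rp) ->].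
by rewrite adj_parent_edges yr fy eqxx orbT -val_eqE /= gtn_eqF.
Qed.

Definition MD_of r f : {set V} := @MD n (r, parent_edges r f).

(** A simple path from the root only passes from parent to child; conversely, a decreasing path
    repeats no vertex. *)
Lemma MD_connect r f : f \in parent_maps r ->
  MD_of r f = [set v | connect (fun a b => (f b == a) && (b < a)%N) r v].
Proof.
move=> /parent_mapsP[gf fr]; apply/setP => v; rewrite /MD_of !inE.
apply/existsP/connectP => [[p /and4P[pp up /eqP pv sp]]|[p pp vE]].
  exists p => //; rewrite /= in pp sp.
  rewrite (path_relI (fun a b => f b == a) (fun a b : V => (b < a)%N)) sp andbT.
  by apply: (path_from_root pp up); rewrite fr; case/andP: up.
move: pp; rewrite (path_relI (fun a b => f b == a) (fun a b : V => (b < a)%N)) => /andP[pf pd].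
have up : uniq (r :: p).
  apply: (@sorted_uniq _ (fun a b : V => (b < a)%N)) => // [y x z /= yx zy|x].
    exact: ltn_trans zy yx.
  exact: ltnn.
have csize : (size p <= #|V|)%N.
  by apply: ltnW; rewrite -[(size p).+1]/(size (r :: p)) -(card_uniqP up) max_card.
exists (Bseq csize); apply/and4P; split; rewrite ?vE //.
have : path (fun a b => (f b == a) && (b < a)%N) r p.
  by rewrite (path_relI (fun a b => f b == a) (fun a b : V => (b < a)%N)) pf pd.
have rp : r \notin p by case/andP: up.
exact: path_to_root.
Qed.

(** A decreasing path to a vertex other than the root arrives from its parent, so this last step can
    be removed or added. *)
Lemma isMD_MD r f : f \in parent_maps r -> isMD f r (MD_of r f).
Proof.
move=> fP; rewrite MD_connect //; apply/andP; split; first by rewrite inE connect0.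
apply/forallP => x; apply/implyP => xr; rewrite !inE; apply/eqP.
apply/connectP/andP => [[p]|[/connectP[p pp fE] xf]].
  case/lastP: p => [_ xE|p y]; first by rewrite xE eqxx in xr.
  rewrite rcons_path last_rcons => /andP[pp /andP[/eqP fy yl]] ->.
  by rewrite fy; split=> //; apply/connectP; exists p.
by exists (rcons p x); rewrite ?last_rcons // rcons_path pp -fE eqxx.
Qed.

(** * Counting trees by the size of MD(T) *)

Lemma card_rtreesMD k :
  #|rtreesMD n k| = (\sum_r #|[set f in parent_maps r | #|MD_of r f| == k.+1]|)%N.
Proof.
pose P := [set p : V * {ffun V -> V} | (p.2 \in parent_maps p.1) &&
                                      (#|MD_of p.1 p.2| == k.+1)].
pose tree (p : V * {ffun V -> V}) := (p.1, parent_edges p.1 p.2).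
have inP r f : ((r, f) \in P) = (f \in parent_maps r) && (#|MD_of r f| == k.+1) by rewrite inE.
have tree_inj : {in P &, injective tree}.
  move=> [r f] [r' g]; rewrite !inP => /andP[fP _] /andP[gP _] [rr].
  by move: gP; rewrite -rr => gP /(parent_edges_inj fP gP) ->.
have -> : rtreesMD n k = tree @: P.
  apply/setP => -[r E]; rewrite !inE /=; apply/andP/imsetP => [[tE cE]|[[r' f]]].
    have [f fP fE] := tree_parent_map r tE; exists (r, f); last by rewrite /tree /= fE.
    by rewrite inP fP /MD_of fE cE.
  by rewrite inP => /andP[fP cf] [-> ->]; rewrite parent_map_tree.
rewrite card_in_imset // -sum1_card.
rewrite (eq_bigl (fun p => (p.2 \in parent_maps p.1) &&
   (#|MD_of p.1 p.2| == k.+1))); last by move=> p; rewrite inE.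
rewrite -(pair_big_dep xpredT (fun r f => (f \in parent_maps r) &&
   (#|MD_of r f| == k.+1)) (fun _ _ => 1%N)) /=.
by apply: eq_bigr => r _; rewrite -sum1_card; apply: eq_bigl => f; rewrite inE.
Qed.

(** For each value [S] of MD(T) the ratio is |S| - 1, which depends on the size only. With k + 2
    vertices in MD(T), the trees are those of T_{n,k+1}. *)
Lemma card_MD_split r k :
  #|[set f in parent_maps r | #|MD_of r f| == k.+2]| =
  (k.+1 * #|[set f in parent_maps r | split_root f r & #|MD_of r f| == k.+2]|)%N.
Proof.
have mdE f (S : {set V}) : (f \in parent_maps r) && (MD_of r f == S) = (f \in MD_maps r S).
  rewrite [RHS]inE; apply: andb_id2l => fP; apply/eqP/idP => [<-|]; first exact: isMD_MD.
  by have /parent_mapsP[gf _] := fP; apply: isMD_inj => //; exact: isMD_MD.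
rewrite -!sum1_card.
rewrite (partition_big (MD_of r) (fun S => #|S| == k.+2)) => [|f]; last by rewrite inE => /andP[].
rewrite [in RHS](partition_big (MD_of r) (fun S => #|S| == k.+2)) => [|f]; last by rewrite inE => /and3P[].
rewrite big_distrr /=; apply: eq_bigr => S /eqP Sk.
have S1 : (1 < #|S|)%N by rewrite Sk.
rewrite (eq_bigl (mem (MD_maps r S))); last first.
  move=> f; rewrite /= -mdE [in LHS]inE -andbA; congr (_ && _).
  by case: (eqVneq (MD_of r f) S) => [->|]; rewrite ?andbF ?andbT // Sk eqxx.
rewrite [in RHS](eq_bigl (mem [set f in MD_maps r S | split_root f r])); last first.
  move=> f; rewrite /= [RHS]inE -mdE [in LHS]inE -!andbA; congr (_ && _).
  by case: (eqVneq (MD_of r f) S) => [->|]; rewrite ?andbF ?andbT // Sk eqxx andbT.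
by rewrite !sum1_card card_MD_maps_ratio // Sk.
Qed.

(** The root and its smaller child both lie in MD(T). Hence the sum over k >= 1 misses no tree with
    a split root. *)
Lemma card_MD_split_root r f : f \in parent_maps r -> split_root f r ->
  (1 < #|MD_of r f|)%N.
Proof.
move=> fP /cards1P[c cE]; have : c \in smaller_children f r by rewrite cE inE.
rewrite inE => /andP[cr /eqP fc].
have /andP[rS /forallP h] := isMD_MD fP.
have c_r : c != r by rewrite -val_eqE /= ltn_eqF.
have cS : c \in MD_of r f by rewrite (eqP (implyP (h c) c_r)) fc rS.
by rewrite (cardsD1 r) rS (cardsD1 c) in_setD1 c_r cS.
Qed.

Lemma sum_rtreesMD : (0 < n)%N ->
  \sum_(1 <= k < n.+1) (k%:R^-1 * #|rtreesMD n k|%:R : rat) = n%:R ^+ n.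
Proof.
move=> n0; rewrite -sum_card_split_root // big_add1 /=.
rewrite (eq_bigr (fun k => (\sum_r #|[set f in parent_maps r |
    split_root f r & #|MD_of r f| == k.+2]|)%N%:R)) => [|k _]; last first.
  rewrite card_rtreesMD; under eq_bigr do rewrite card_MD_split.
  by rewrite -big_distrr /= natrM mulKf // pnatr_eq0.
rewrite -natr_sum; congr _%:R; rewrite exchange_big /=; apply: eq_bigr => r _.
rewrite -[RHS]sum1_card big_mkord.
rewrite (eq_bigr (fun k : 'I_n => \sum_(f in [set f in parent_maps r | split_root f r])
    (#|MD_of r f| == k.+2 : nat)))%N; last first.
  move=> k _; rewrite -sum1_card big_mkcond [RHS]big_mkcond /=; apply: eq_bigr => f _.
  rewrite ![f \in finset _]inE andbA.
  by case: (_ && split_root f r); case: (_ == _).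
rewrite exchange_big /=; apply: eq_bigr => f /setIdP[fP sf].
have MD2 := card_MD_split_root fP sf.
have MDn : (#|MD_of r f| <= n.+1)%N by rewrite -[X in (_ <= X)%N]card_ord max_card.
(* Each such tree is counted once, at the shifted index |MD(T)| - 2. *)
have kn : (#|MD_of r f|.-2 < n)%N by lia.
rewrite (bigD1 (Ordinal kn)) //= big1 => [|k].
  by have /eqP -> : #|MD_of r f| = #|MD_of r f|.-2.+2 by lia.
by rewrite -val_eqE /=; case: (#|MD_of r f| =P k.+2) => // ->; rewrite eqxx.
Qed.

End Trees.

Theorem theorem3p4 (n : nat) (n_gt0 : (0 < n)%N) :
  \sum_(1 <= k < n.+1) (k%:R^-1 * #|rtreesMD n k|%:R : rat) =
    \sum_(1 <= k < n.+1) (k%:R^-1 * #|funs_onto_first n k|%:R : rat) /\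
  \sum_(1 <= k < n.+1) (k%:R^-1 * #|funs_onto_first n k|%:R : rat) =
    n%:R ^+ n.
Proof. by rewrite sum_rtreesMD // sum_funs_onto_first. Qed.
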